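(* Let $\mathcal{A}$ be a unital associative algebra over $\mathbb{C}$ graded by an abelian group $G$, and let $M$ be a simple (not necessarily graded) $\mathcal{A}$-module. Then for any thin covering $\{M_g\mid g\in G\}$ of $M$, the external direct sum $$\widetilde M:=\bigoplus_{g\in G}M_g$$ is a graded-simple $\mathcal{A}$-module.
   Context: Modules are left modules. A ($G$-)covering of $M$ is a family of subspaces $\{M_g\mid g\in G\}$ of $M$ with $\sum_{g\in G}M_g=M$ and $\mathcal{A}_gM_h\subseteq M_{g+h}$ for all $g,h\in G$. It is thin if whenever $\{N_g\}$ is a covering of $M$ with $N_g\subseteq M_g$ for all $g$, then $N_g=M_g$ for all $g$. The space $\widetilde M$ is a $G$-graded $\mathcal{A}$-module with $\widetilde M_g:=M_g$, where $a\in\mathcal{A}_g$ maps $\widetilde M_h=M_h$ to $\widetilde M_{g+h}=M_{g+h}$ by its action on $M$. Graded-simple means nonzero with no proper nonzero $G$-graded submodules. *)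

(* Defs.v *)
From HB Require Import structures.
From mathcomp Require Import all_boot all_order all_algebra finmap.
From mathcomp Require Import complex.
From mathcomp Require Import all_classical reals.

Set Implicit Arguments.
Unset Strict Implicit.
Unset Printing Implicit Defensive.

Import GRing.Theory.

Local Open Scope ring_scope.
Local Open Scope classical_set_scope.

Section Families.
Variables (G : zmodType) (V : zmodType).
Implicit Type W : G -> set V.

Definition sumset W : set V :=
  [set v | exists (J : {fset G}) (f : G -> V),
      (forall g, W g (f g)) /\ v = \sum_(g <- J) f g].

Definition independent W : Prop :=
  forall (J : {fset G}) (f : G -> V), (forall g, W g (f g)) ->
    \sum_(g <- J) f g = 0 -> forall g, g \in J -> f g = 0.

Definition direct_decomposition W : Prop :=
  sumset W = [set: V] /\ independent W.

End Families.

(* A module over a unital K-algebra is a K-vector space through c |-> c%:A. *)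
Definition subspace (K : fieldType) (A : algType K) (M : lmodType A)
    (S : set M) : Prop :=
  S 0 /\ forall (c : K) (u v : M), S u -> S v -> S (c%:A *: u + v).

Record grading (K : fieldType) (A : algType K) (G : zmodType) := Grading {
  grading_comp :> G -> set A;
  grading_subspace : forall g, submod_closed (mem (grading_comp g));
  grading_direct : direct_decomposition grading_comp;
  grading_mul : forall g h a b,
    grading_comp g a -> grading_comp h b -> grading_comp (g + h) (a * b) }.

Section Modules.
Variables (K : fieldType) (A : algType K) (G : zmodType) (gA : grading A G).

Definition submodule (M : lmodType A) (S : set M) : Prop :=
  submod_closed (mem S).

Definition simple_module (M : lmodType A) : Prop :=
  (exists x : M, x <> 0) /\
  forall S : set M, submodule S -> S = [set 0] \/ S = [set: M].

Record covering (M : lmodType A) := Covering {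
  covering_comp :> G -> set M;
  covering_subspace : forall g, subspace (covering_comp g);
  covering_sum : sumset covering_comp = [set: M];
  covering_act : forall g h a m,
    gA g a -> covering_comp h m -> covering_comp (g + h) (a *: m) }.

Definition thin (M : lmodType A) (N : covering M) : Prop :=
  forall N' : covering M, (forall g, N' g `<=` N g) -> forall g, N' g = N g.

Definition graded_module (V : lmodType A) (W : G -> set V) : Prop :=
  [/\ forall g, subspace (W g),
      direct_decomposition W &
      forall g h a v, gA g a -> W h v -> W (g + h) (a *: v)].

Definition graded_submodule (V : lmodType A) (W : G -> set V) (S : set V) :=
  submodule S /\ S `<=` sumset (fun g => S `&` W g).

Definition graded_simple (V : lmodType A) (W : G -> set V) : Prop :=
  [/\ graded_module W,
      exists x : V, x <> 0 &
      forall S, graded_submodule W S -> S = [set 0] \/ S = [set: V]].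

End Modules.

Section HomogeneousComponents.
Variables (K : fieldType) (A : algType K) (G : zmodType) (gA : grading A G).
Implicit Types (a b : A) (g h : G).

Lemma grading0 g : gA g 0.
Proof. by case: (grading_subspace gA g); rewrite inE. Qed.

Lemma gradingD g a b : gA g a -> gA g b -> gA g (a + b).
Proof.
move=> ga gb; have [_ /(_ 1 a b)] := grading_subspace gA g.
by rewrite !inE scale1r; exact.
Qed.

Lemma gradingB g a b : gA g a -> gA g b -> gA g (a - b).
Proof.
move=> ga gb; have [_ /(_ (-1) b a)] := grading_subspace gA g.
by rewrite !inE scaleN1r addrC; exact.
Qed.

Definition decomposes a (f : G -> A) : Prop :=
  (forall g, gA g (f g)) /\
  exists2 J : {fset G}, forall g, g \notin J -> f g = 0 &
                        a = \sum_(g <- J) f g.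

Lemma decomposes_ex a : exists f, decomposes a f.
Proof.
have [/seteqP[_ /(_ a I)[J [f [gf ->]]]] _] := grading_direct gA.
exists (fun g => if g \in J then f g else 0); split.
  by move=> g; case: ifP => // _; exact: grading0.
exists J; first by move=> g /negPf ->.
by apply: eq_big_seq => g ->.
Qed.

Lemma sum_fsub (V : zmodType) (J J' : {fset G}) (f : G -> V) :
  (J `<=` J')%fset -> (forall g, g \notin J -> f g = 0) ->
  \sum_(g <- J) f g = \sum_(g <- J') f g.
Proof.
move=> JJ' f0; rewrite -(fsbigTE J)// -(fsbigTE J')// => g gJ'.
by apply: f0; apply: contra gJ' => /(fsubsetP JJ').
Qed.

Lemma decomposes_uniq a f f' : decomposes a f -> decomposes a f' -> f = f'.
Proof.
move=> [gf [J f0 aE]] [gf' [J' f'0 aE']]; apply/funext => g.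
have [_ indep] := grading_direct gA.
pose L := (J `|` J')%fset.
have fL i : i \notin L -> f i = 0 /\ f' i = 0.
  by rewrite inE negb_or => /andP[/f0 -> /f'0 ->].
case: (boolP (g \in L)) => [gL|/fL[-> ->//]].
apply/eqP; rewrite -subr_eq0; apply/eqP.
apply: (indep L (fun g => f g - f' g)) => //.
  by move=> i; exact: gradingB.
rewrite sumrB -(sum_fsub (fsubsetUl J J') f0) -(sum_fsub (fsubsetUr J J') f'0).
by rewrite -aE -aE' subrr.
Qed.

Definition component a : G -> A := projT1 (cid (decomposes_ex a)).

Lemma componentP a : decomposes a (component a).
Proof. exact: projT2 (cid (decomposes_ex a)). Qed.

Lemma component_homog g a : gA g a ->
  component a = fun h => if h == g then a else 0.
Proof.
move=> ga; apply: (decomposes_uniq (componentP a)); split.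
  by move=> h; case: eqP => [->//|_]; exact: grading0.
exists [fset g]%fset; last by rewrite big_seq_fset1 eqxx.
by move=> h; rewrite inE => /negPf ->.
Qed.

Lemma componentD a b g : component (a + b) g = component a g + component b g.
Proof.
suff -> : component (a + b) = fun g => component a g + component b g by [].
apply: (decomposes_uniq (componentP _)).
have [ga [J aJ aE]] := componentP a; have [gb [J' bJ' bE]] := componentP b.
split; first by move=> h; exact: gradingD.
exists (J `|` J')%fset.
  by move=> h; rewrite inE negb_or => /andP[/aJ -> /bJ' ->]; rewrite addr0.
rewrite big_split/= -(sum_fsub (fsubsetUl J J') aJ).
by rewrite -(sum_fsub (fsubsetUr J J') bJ') -aE -bE.
Qed.

Lemma grading_ind (P : A -> Prop) :
  (forall g a, gA g a -> P a) -> (forall a b, P a -> P b -> P (a + b)) ->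
  forall a, P a.
Proof.
move=> Ph PD a; have [ga [J _ ->]] := componentP a.
by elim/big_ind: _ => [|//|g _]; [exact: (Ph 0 0 (grading0 0))|exact: Ph (ga g)].
Qed.

Lemma grading1 : gA 0 1.
Proof.
have [g1 [J J0 oneE]] := componentP 1; set e := component 1 in g1 J0 oneE.
have e0l a : e 0 * a = a.
  elim/grading_ind: a => [g a ga|a b IHa IHb]; last by rewrite mulrDr IHa IHb.
  pose f h := e (h - g) * a.
  suff : component a = f.
    move=> /(congr1 (@^~ g)); rewrite (component_homog ga) eqxx /f subrr.
    by move=> <-.
  apply: (decomposes_uniq (componentP a)); split.
    by move=> h; rewrite -[h in gA h](subrK g); exact: grading_mul.
  exists [fset (h + g)%R | h in J]%fset => [h hJ|].
    rewrite /f J0 ?mul0r//; apply: contra hJ => hJ; apply/imfsetP.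
    by exists (h - g); rewrite //= subrK.
  rewrite big_imfset/=; last by move=> x y _ _ /addIr.
  rewrite -[LHS]mul1r oneE mulr_suml; apply: eq_bigr => h _.
  by rewrite /f addrK.
by rewrite -(e0l 1) mulr1; exact: g1.
Qed.

End HomogeneousComponents.

(* The external direct sum of the M_g: functions x : G -> M of finite support  *)
(* with x g in M_g. The element a acts through its homogeneous components,     *)
(* so that a in A_g sends the h-th coordinate to the (g + h)-th one.           *)
Section ExternalSum.
Variables (K : fieldType) (A : algType K) (G : zmodType) (gA : grading A G).
Variables (M : lmodType A) (N : covering gA M).

Lemma covering0 g : N g 0.
Proof. by case: (covering_subspace N g). Qed.

Lemma coveringD g u v : N g u -> N g v -> N g (u + v).
Proof.
by move=> gu gv; have [_ /(_ 1 u v gu gv)] := covering_subspace N g;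
  rewrite !scale1r.
Qed.

Lemma coveringB g u v : N g u -> N g v -> N g (u - v).
Proof.
move=> gu gv; have [_ /(_ (-1) v u gv gu)] := covering_subspace N g.
by rewrite scaleN1r scaleN1r addrC.
Qed.

Definition extsum_pred : {pred G -> M} :=
  [pred x : G -> M |
    `[< (forall g, N g (x g)) /\ finite_set [set g | x g <> 0] >]].

Lemma extsum_zmod_closed : zmod_closed extsum_pred.
Proof.
split=> [|x y].
  apply/asboolP; split=> [g|]; first exact: covering0.
  by apply: (sub_finite_set _ (finite_set0 G)) => g /=.
move=> /asboolP[Nx fx] /asboolP[Ny fy]; apply/asboolP; split.
  by move=> g; exact: coveringB.
apply: (@sub_finite_set _ _ ([set g | x g <> 0] `|` [set g | y g <> 0])).
  move=> g /= xy0; case: (pselect (x g = 0)) => [x0|]; [right|by left].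
  by move=> y0; apply: xy0; rewrite !fctE x0 y0 subrr.
by rewrite finite_setU.
Qed.

HB.instance Definition _ :=
  GRing.isZmodClosed.Build (G -> M) extsum_pred extsum_zmod_closed.

Record extsum := ExtSum {
  extsum_fun :> G -> M;
  extsum_funP : extsum_fun \in extsum_pred }.

HB.instance Definition _ := [isSub for extsum_fun].
HB.instance Definition _ := [Choice of extsum by <:].
HB.instance Definition _ := [SubChoice_isSubZmodule of extsum by <:].

Definition extsum_act_fun (a : A) (x : G -> M) (h : G) : M :=
  \sum_(g \in [set: G]) component gA a g *: x (h - g).

Lemma extsum_act_homog g a x h : gA g a ->
  extsum_act_fun a x h = a *: x (h - g).
Proof.
move=> ga; rewrite /extsum_act_fun (fsbigTE [fset g]%fset).
  by rewrite big_seq_fset1 (component_homog ga) eqxx.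
by move=> i; rewrite inE (component_homog ga) => /negPf ->; rewrite scale0r.
Qed.

Lemma extsum_actDl a b x h : extsum_act_fun (a + b) x h =
  extsum_act_fun a x h + extsum_act_fun b x h.
Proof.
have [_ [J J0 _]] := componentP gA a; have [_ [J' J'0 _]] := componentP gA b.
have L0 g : g \notin (J `|` J')%fset ->
    component gA a g = 0 /\ component gA b g = 0.
  by rewrite inE negb_or => /andP[/J0 -> /J'0 ->].
rewrite /extsum_act_fun !(fsbigTE (J `|` J')%fset).
- by rewrite -big_split/=; apply: eq_bigr => g _; rewrite componentD scalerDl.
- by move=> g /L0[_ ->]; rewrite scale0r.
- by move=> g /L0[-> _]; rewrite scale0r.
- by move=> g /L0[a0 b0]; rewrite componentD a0 b0 addr0 scale0r.
Qed.

Lemma extsum_act_subproof a (x : extsum) : extsum_act_fun a x \in extsum_pred.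
Proof.
elim/(grading_ind (gA := gA)): a => [g a ga|a b /asboolP[Na fa] /asboolP[Nb fb]].
  have /asboolP[Nx fx] := extsum_funP x; apply/asboolP; split=> [h|].
    rewrite (extsum_act_homog _ _ ga) -[h in N h](subrK g) addrC.
    exact: covering_act.
  apply: (sub_finite_set _ (finite_image (fun h => h + g) fx)) => h /=.
  rewrite (extsum_act_homog _ _ ga) => axh; exists (h - g); last by rewrite subrK.
  by move=> /= x0; apply: axh; rewrite x0 scaler0.
apply/asboolP; split=> [h|]; first by rewrite extsum_actDl; exact: coveringD.
apply: (@sub_finite_set _ _ ([set h | extsum_act_fun a x h <> 0] `|`
                             [set h | extsum_act_fun b x h <> 0])).
  move=> h /= ab0; case: (pselect (extsum_act_fun a x h = 0)); last by left.
  by move=> a0; right=> b0; apply: ab0; rewrite extsum_actDl a0 b0 addr0.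
by rewrite finite_setU.
Qed.

Definition extsum_act a (x : extsum) : extsum :=
  ExtSum (extsum_act_subproof a x).

Lemma extsumP (x y : extsum) : (forall h, x h = y h) -> x = y.
Proof. by move=> xy; apply/val_inj/funext. Qed.

Fact extsum_actA a b x : extsum_act a (extsum_act b x) = extsum_act (a * b) x.
Proof.
apply: extsumP => h.
elim/(grading_ind (gA := gA)): a => [g a ga|a a' IHa IHa']; last first.
  by move: IHa IHa'; rewrite /= mulrDl !extsum_actDl => -> ->.
elim/(grading_ind (gA := gA)): b => [k b kb|b b' IHb IHb'].
  rewrite /= (extsum_act_homog _ _ ga) (extsum_act_homog _ _ kb).
  by rewrite (extsum_act_homog _ _ (grading_mul ga kb)) scalerA opprD addrA.
move: IHb IHb'; rewrite /= mulrDr !extsum_actDl => <- <-.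
by rewrite !(extsum_act_homog _ _ ga) /= extsum_actDl scalerDr.
Qed.

Fact extsum_act1 x : extsum_act 1 x = x.
Proof.
apply: extsumP => h.
by rewrite /= (extsum_act_homog _ _ (grading1 gA)) scale1r subr0.
Qed.

Lemma extsum_addE (x y : extsum) h : (x + y) h = x h + y h.
Proof. by []. Qed.

Fact extsum_actDr : right_distributive extsum_act +%R.
Proof.
move=> a x y; apply: extsumP => h; rewrite extsum_addE.
elim/(grading_ind (gA := gA)): a => [g a ga|a b IHa IHb].
  rewrite -[LHS]/(extsum_act_fun a (x + y : extsum) h).
  rewrite -[RHS]/(extsum_act_fun a x h + extsum_act_fun a y h).
  by rewrite !(extsum_act_homog _ _ ga) extsum_addE scalerDr.
by move: IHa IHb; rewrite /= !extsum_actDl => -> ->; rewrite addrACA.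
Qed.

Fact extsum_act_addl x : {morph extsum_act^~ x : a b / a + b}.
Proof.
by move=> a b; apply: extsumP => h; rewrite extsum_addE /= extsum_actDl.
Qed.

HB.instance Definition _ := GRing.Zmodule_isLmodule.Build A extsum
  extsum_actA extsum_act1 extsum_actDr extsum_act_addl.

(* The copy of M_g in the external direct sum. *)
Definition extsum_comp (g : G) : set extsum :=
  [set x | forall h, h != g -> x h = 0].

Lemma extsum_scaleE g a (x : extsum) h : gA g a -> (a *: x) (g + h) = a *: x h.
Proof. by move=> ga; rewrite [LHS](extsum_act_homog _ _ ga) addrC addKr. Qed.

End ExternalSum.

Arguments extsum_comp {K A G gA M} N g.

(* Main.v *)
Require Import Defs.
From mathcomp Require Import all_boot all_order all_algebra finmap.
From mathcomp Require Import complex.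
From mathcomp Require Import all_classical reals.

(** Let S be a nonzero graded submodule of the external direct sum of a thin
    covering N of a simple module M.  Reading off the g-th coordinate of the
    homogeneous elements of degree g in S gives subspaces S_g of N_g, again
    permuted by the grading of A ([trace_act]).  The sum of the S_g inside M is
    therefore a submodule ([sumset_submodule]), and it is nonzero because a
    nonzero element of S has a nonzero homogeneous component lying in S.  As M
    is simple, this sum is M: the S_g form a covering contained in N, and
    thinness forces S_g = N_g for all g.  Hence S contains every homogeneous
    element of the direct sum, and so is everything.

    That the direct sum is a graded module comes from the evaluation formula
    [extsum_sum_compE] for sums of homogeneous elements and from the
    decomposition [extsum_decomposition] of an element into its components; it
    is nonzero because M is nonzero and is the sum of the N_g. *)

Set Implicit Arguments.
Unset Strict Implicit.
Unset Printing Implicit Defensive.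

Import GRing.Theory.

Local Open Scope ring_scope.
Local Open Scope classical_set_scope.

(** * Sums of families of subspaces *)

Section SumOfSubspaces.
Variables (K : fieldType) (A : algType K) (G : zmodType) (gA : grading A G).
Variables (V : lmodType A) (W : G -> set V).
Hypothesis Wsub : forall g, subspace (W g).

Lemma subspace0 (S : set V) : subspace S -> S 0.
Proof. by case. Qed.

Lemma subspaceD (S : set V) u v : subspace S -> S u -> S v -> S (u + v).
Proof. by move=> [_ SD] Su Sv; have := SD 1 u v Su Sv; rewrite !scale1r. Qed.

Lemma sumset_comp g v : W g v -> sumset W v.
Proof.
move=> Wv; exists [fset g]%fset, (fun h => if h == g then v else 0); split.
  by move=> h; case: eqP => [->|_] //; exact: subspace0.
by rewrite big_seq_fset1 eqxx.
Qed.

Lemma sumset0 : sumset W 0.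
Proof. by apply: (@sumset_comp 0); exact: subspace0. Qed.

Lemma sumsetD u v : sumset W u -> sumset W v -> sumset W (u + v).
Proof.
move=> [J [f [Wf ->]]] [J' [f' [Wf' ->]]].
(* Cut both families off outside their index sets, so that both sums can be
   taken over the union. *)
pose cut (I : {fset G}) (k : G -> V) g := if g \in I then k g else 0.
have Wcut I k : (forall g, W g (k g)) -> forall g, W g (cut I k g).
  by move=> Wk g; rewrite /cut; case: ifP => // _; exact: subspace0.
have cutE I I' k : (I `<=` I')%fset ->
    \sum_(g <- I) k g = \sum_(g <- I') cut I k g.
  move=> II'; rewrite -(sum_fsub II') => [|g /negPf gI]; last by rewrite /cut gI.
  by apply: eq_big_seq => g gI; rewrite /cut gI.
exists (J `|` J')%fset, (fun g => cut J f g + cut J' f' g); split.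
  by move=> g; apply: subspaceD => //; exact: Wcut.
by rewrite big_split/= -!cutE ?fsubsetUl ?fsubsetUr.
Qed.

(** An arbitrary scalar is a sum of homogeneous ones, and a homogeneous scalar
    merely moves each summand to another member of the family. *)
Lemma sumset_submodule :
    (forall g h a v, gA g a -> W h v -> W (g + h) (a *: v)) ->
  submodule (sumset W).
Proof.
move=> Wact; split=> [|a u v]; rewrite !inE; first exact: sumset0.
move=> Wu Wv; apply: sumsetD => //.
elim/(grading_ind (gA := gA)): a => [g a ga|a b Wa Wb]; last first.
  by rewrite scalerDl; exact: sumsetD.
have [J [f [Wf ->]]] := Wu; rewrite scaler_sumr.
elim/big_ind: _ => [|x y|h _]; [exact: sumset0|exact: sumsetD|].
by apply: sumset_comp; exact: Wact ga (Wf h).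
Qed.

End SumOfSubspaces.

(** * The grading of the external direct sum *)

Section ExternalSumDecomposition.
Variables (K : fieldType) (A : algType K) (G : zmodType) (gA : grading A G).
Variables (M : lmodType A) (N : covering gA M).
Implicit Types (x y : extsum N) (g h : G).

Lemma extsum_valE x g : N g (x g).
Proof. by have /asboolP[Nx _] := extsum_funP x; exact: Nx. Qed.

Lemma extsum_sumE (J : {fset G}) (f : G -> extsum N) h :
  (\sum_(g <- J) f g) h = \sum_(g <- J) f g h.
Proof. by elim/big_ind2: _ => // ? ? ? ? <- <-; rewrite extsum_addE. Qed.

(** A degree contributes to its own coordinate only.  This one formula gives both
    the independence of the homogeneous parts and the decomposition of an
    element. *)
Lemma extsum_sum_compE (J : {fset G}) (f : G -> extsum N) h :
    (forall g, extsum_comp N g (f g)) ->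
  (\sum_(g <- J) f g) h = if h \in J then f h h else 0.
Proof.
move=> Wf; rewrite extsum_sumE.
have off g : g != h -> f g h = 0 by move=> gh; apply: Wf; rewrite eq_sym.
case: (boolP (h \in J)) => hJ.
  by rewrite (big_fsetD1 h)//= big_seq big1 ?addr0// => g /fsetD1P[/off].
by rewrite big_seq big1// => g gJ; apply: off; apply: contraNneq hJ => <-.
Qed.

(** The family x need not have finite support: truncating it to a single degree
    makes it an element of the direct sum. *)
Lemma extsum_trunc_subproof g (x : G -> M) : (forall h, N h (x h)) ->
  (fun h => if h == g then x h else 0) \in extsum_pred N.
Proof.
move=> Nx; apply/asboolP; split=> [h|].
  by case: ifP => // _; exact: covering0.
by apply: (sub_finite_set _ (finite_set1 g)) => h /=; case: eqP.
Qed.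

Definition extsum_proj g x : extsum N :=
  ExtSum (extsum_trunc_subproof g (extsum_valE x)).

Lemma extsum_projE g x : extsum_proj g x g = x g.
Proof. by rewrite /= eqxx. Qed.

Lemma extsum_proj_comp g x : extsum_comp N g (extsum_proj g x).
Proof. by move=> h /negPf hg; rewrite /= hg. Qed.

Lemma extsum_comp_ext g x y :
  extsum_comp N g x -> extsum_comp N g y -> x g = y g -> x = y.
Proof.
move=> Wx Wy xy; apply: extsumP => h.
by have [->//|hg] := eqVneq h g; rewrite Wx// Wy.
Qed.

Lemma extsum_decomposition x :
  exists J : {fset G}, x = \sum_(g <- J) extsum_proj g x.
Proof.
have /asboolP[_ fx] := extsum_funP x.
exists (fset_set [set g | x g <> 0]); apply: extsumP => h.
rewrite extsum_sum_compE => [|g]; last exact: extsum_proj_comp.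
rewrite extsum_projE in_fset_set//; case: ifPn => // /negP xh.
by apply: contrapT => xh0; apply: xh; rewrite inE.
Qed.

(** Constants are homogeneous of degree 0, so the field acts coordinatewise. *)
Lemma extsum_constE (c : K) x h : (c%:A *: x) h = c%:A *: x h.
Proof.
have gc : gA 0 c%:A.
  have [_ /(_ c 1 0)] := grading_subspace gA 0; rewrite !inE addr0; apply.
    exact: grading1.
  exact: grading0.
by rewrite -[in LHS](add0r h) extsum_scaleE.
Qed.

Lemma extsum_comp_subspace g : subspace (extsum_comp N g).
Proof.
split=> // c u v Wu Wv h hg.
by rewrite extsum_addE extsum_constE Wu// Wv// scaler0 addr0.
Qed.

Lemma extsum_comp_act g h a x :
  gA g a -> extsum_comp N h x -> extsum_comp N (g + h) (a *: x).
Proof.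
move=> ga Wx k kgh; rewrite -[k](addNKr g) extsum_scaleE//.
rewrite Wx ?scaler0//; apply: contraNneq kgh => <-.
by rewrite addNKr.
Qed.

Lemma extsum_graded_module : graded_module gA (extsum_comp N).
Proof.
split; [exact: extsum_comp_subspace| |exact: extsum_comp_act].
split.
  apply/seteqP; split=> // x _; have [J xE] := extsum_decomposition x.
  by exists J, (extsum_proj^~ x); split=> // g; exact: extsum_proj_comp.
move=> J f Wf f0 g gJ; apply: (extsum_comp_ext (Wf g)) => //.
by have := extsum_sum_compE J g Wf; rewrite f0 gJ.
Qed.

(** If the direct sum vanished, so would every N_g, hence also their sum M. *)
Lemma extsum_nonzero : (exists m : M, m <> 0) -> exists x, x <> 0.
Proof.
move=> [m m0]; apply: contrapT => all0; apply: m0.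
have /seteqP[_ /(_ m I)[J [f [Nf ->]]]] := covering_sum N.
apply: big1 => g _.
(* The vector f g of M, placed in degree g. *)
pose x : extsum N := ExtSum (extsum_trunc_subproof g Nf).
have -> : f g = x g by rewrite /x /= eqxx.
by have -> : x = 0 by apply: contrapT => x0; apply: all0; exists x.
Qed.

End ExternalSumDecomposition.

(** * Traces of graded submodules on the covering *)

Section GradedSubmodules.
Variables (K : fieldType) (A : algType K) (G : zmodType) (gA : grading A G).
Variables (M : lmodType A) (N : covering gA M) (S : set (extsum N)).
Hypothesis Ssub : submodule S.
Implicit Types (x : extsum N) (g h : G).

Lemma submodule0 : S 0.
Proof. by case: Ssub; rewrite inE. Qed.

Lemma submodule_lin a u v : S u -> S v -> S (a *: u + v).
Proof. by move=> Su Sv; case: Ssub => _ /(_ a u v); rewrite !inE; apply. Qed.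

Lemma submoduleD u v : S u -> S v -> S (u + v).
Proof. by move=> Su Sv; rewrite -[u]scale1r; exact: submodule_lin. Qed.

(** The g-th coordinate is injective on degree g, so [trace g] is a copy inside M
    of the degree g part of S. *)
Definition trace g : set M :=
  [set m | exists x, [/\ S x, extsum_comp N g x & x g = m]].

Lemma trace_sub g : trace g `<=` N g.
Proof. by move=> _ [x [_ _ <-]]; exact: extsum_valE. Qed.

Lemma trace_subspace g : subspace (trace g).
Proof.
have Wsub := extsum_comp_subspace N g.
split=> [|c _ _ [x [Sx Wx <-]] [y [Sy Wy <-]]].
  by exists 0; split=> //; exact: submodule0.
exists (c%:A *: x + y); split; [exact: submodule_lin|exact: Wsub.2|].
by rewrite extsum_addE extsum_constE.
Qed.

Lemma trace_act g h a m : gA g a -> trace h m -> trace (g + h) (a *: m).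
Proof.
move=> ga [x [Sx Wx <-]]; exists (a *: x); split.
- by rewrite -[a *: x]addr0; apply: submodule_lin => //; exact: submodule0.
- exact: extsum_comp_act.
- exact: extsum_scaleE.
Qed.

(** A graded submodule contains the homogeneous components of its elements, so if
    all traces vanish, then so does every coordinate of every element of S.
    Cancellation between the traces inside M is harmless, since each of them lies
    separately in their sum. *)
Lemma trace_nonzero x : S `<=` sumset (fun g => S `&` extsum_comp N g) ->
  S x -> x <> 0 -> sumset trace <> [set 0].
Proof.
move=> Sgr Sx x0 trace0; apply: x0; have [J [f [Sf xE]]] := Sgr _ Sx.
rewrite xE; apply: extsumP => h.
rewrite extsum_sum_compE => [|g]; last by case: (Sf g).
case: ifP => // _; have : sumset trace (f h h).
  apply: (sumset_comp trace_subspace (g := h)).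
  by exists (f h); case: (Sf h).
by rewrite trace0.
Qed.

(** A homogeneous element is determined by its only possibly nonzero coordinate,
    so equality of the traces with the N_g puts every homogeneous component of
    every element in S. *)
Lemma full_of_trace : (forall g, trace g = N g) -> S = [set: extsum N].
Proof.
move=> traceN; apply/seteqP; split=> // x _.
have [J ->] := extsum_decomposition x.
elim/big_ind: _ => [|u v|g _]; [exact: submodule0|exact: submoduleD|].
have [y [Sy Wy yx]] : trace g (x g) by rewrite traceN; exact: extsum_valE.
suff -> : extsum_proj g x = y by [].
have Wx : extsum_comp N g (extsum_proj g x) by exact: extsum_proj_comp.
by apply: (extsum_comp_ext Wx Wy); rewrite extsum_projE yx.
Qed.

Definition trace_covering (trace_full : sumset trace = [set: M]) :
  covering gA M := Covering trace_subspace trace_full trace_act.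

End GradedSubmodules.

(** The argument works over an arbitrary field. *)
Lemma thin_covering_graded_simple (K : fieldType) (A : algType K) (G : zmodType)
    (gA : grading A G) (M : lmodType A) (N : covering gA M) :
  simple_module M -> thin N -> graded_simple gA (extsum_comp N).
Proof.
move=> [M0 Msimple] Nthin; split; first exact: extsum_graded_module.
  exact: extsum_nonzero.
move=> S [Ssub Sgr].
case: (pselect (exists2 x, S x & x <> 0)) => [[x Sx x0]|S0]; last first.
  left; apply/seteqP; split=> [x Sx|_ ->]; last exact: submodule0.
  by apply: contrapT => x0; apply: S0; exists x.
right; apply: full_of_trace => //.
have sumsub := sumset_submodule (trace_subspace Ssub)
  (@trace_act _ _ _ _ _ _ _ Ssub).
case: (Msimple _ sumsub) => [/(trace_nonzero Ssub Sgr Sx x0)//|trace_full].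
exact: (Nthin (trace_covering Ssub trace_full)) (@trace_sub _ _ _ _ _ _ _).
Qed.

Local Open Scope complex_scope.

Theorem theorem1p3 (R : realType) (G : zmodType) (A : algType R[i])
    (gA : grading A G) (M : lmodType A) (N : covering gA M) :
  simple_module M -> thin N -> graded_simple gA (extsum_comp N).
Proof. exact: thin_covering_graded_simple. Qed.
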